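(* Let $\{x_k\}$ be a sequence of real numbers converging to $x_*$ with $x_k \neq x_*$ for all large $k$, let $e_k = |x_k - x_*|$, and let $p \in \mathbb{N}$. Then $\{x_k\}$ converges with $p$-step Q-order at least $\alpha$ for some $\alpha \geq 1$ if and only if there exist $c \in (0,1)$ and $K \in \mathbb{N}$ such that $$e_{k+p} \leq c^{p}\, e_k \quad \text{for all } k \geq K.$$
   Context: $\mathbb{N} = \{1,2,\dots\}$; sequences are indexed by integers $k \geq 0$. All quotients below are considered for $k$ large enough that they are defined, and limits superior are taken in $[0,+\infty]$. For $p \in \mathbb{N}$ and $\alpha \geq 1$ define $$Q_1^{(p)}(x_k) = \left(\frac{e_{k+p}}{e_k}\right)^{1/p}, \qquad Q_\alpha^{(p)}(x_k) = \left(\frac{e_{k+p}}{e_k^{\alpha^p}}\right)^{\frac{\alpha-1}{\alpha^p-1}} \ \text{ if } \alpha>1, \qquad \overline{Q}_\alpha^{(p)}(x_k) = \limsup_{k\to\infty} Q_\alpha^{(p)}(x_k).$$ The sequence $\{x_k\}$ converges with $p$-step Q-order at least $1$ if $\overline{Q}_1^{(p)}(x_k) < 1$, and with $p$-step Q-order at least $\alpha$, for $\alpha > 1$, if $\overline{Q}_\alpha^{(p)}(x_k) < \infty$. *)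

(* Defs.v *)
From HB Require Import structures.
From mathcomp Require Import all_boot all_order all_algebra.
From mathcomp Require Import boolp classical_sets reals ereal topology.
From mathcomp Require Import normedtype sequences exp.

Set Implicit Arguments.
Unset Strict Implicit.
Unset Printing Implicit Defensive.

Import Order.TTheory GRing.Theory Num.Theory.
Import numFieldNormedType.Exports.

Local Open Scope classical_set_scope.
Local Open Scope ring_scope.

Definition err (R : realType) (x : R^nat) (xs : R) (k : nat) : R :=
  `|x k - xs|.

(* For an index k with [err x xs k = 0] the quotient has a junk value; this
   happens for finitely many k only if [x k != xs] eventually, and finitely
   many terms do not affect the limit superior below. *)
Definition Qquot (R : realType) (p : nat) (alpha : R) (x : R^nat) (xs : R)
    (k : nat) : R :=
  if alpha == 1 then
    (err x xs (k + p)%N / err x xs k) `^ (p%:R^-1)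
  else
    (err x xs (k + p)%N / (err x xs k `^ (alpha ^+ p)))
      `^ ((alpha - 1) / (alpha ^+ p - 1)).

Definition Qbar (R : realType) (p : nat) (alpha : R) (x : R^nat) (xs : R)
    : \bar R :=
  limn_esup (fun k => (Qquot p alpha x xs k)%:E).

Definition Qorder_at_least (R : realType) (p : nat) (alpha : R) (x : R^nat)
    (xs : R) : Prop :=
  (alpha = 1 /\ (Qbar p alpha x xs < 1)%E) \/
  (1 < alpha /\ (Qbar p alpha x xs < +oo)%E).

(* Main.v *)
Require Import Defs.
From HB Require Import structures.
From mathcomp Require Import all_boot all_order all_algebra.
From mathcomp Require Import boolp classical_sets reals ereal topology.
From mathcomp Require Import normedtype sequences exp.

(* Since e_k is eventually positive, order at least 1 and the geometric
   contraction are restatements of each other, up to choosing c strictly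
   between the limit superior and 1. If alpha > 1, a finite limit superior gives
   e_{k+p} <= C e_k^(alpha^p - 1) e_k eventually, and the factor in front of the
   last e_k tends to 0 because alpha^p > 1, so any c > 0 works. *)

Set Implicit Arguments.
Unset Strict Implicit.
Unset Printing Implicit Defensive.

Import Order.TTheory GRing.Theory Num.Theory.
Import numFieldNormedType.Exports.

Local Open Scope classical_set_scope.
Local Open Scope ring_scope.

(** The limit superior is an infimum of suprema over members of [F]; if it lies strictly below [a],
    so does the supremum over some single member. *)
Lemma limf_esup_lt_near (T : choiceType) (X : filteredType T) (R : realType)
    (f : X -> \bar R) (F : set_system X) (FF : Filter F) (a : \bar R) :
  (limf_esup f F < a)%E -> \forall t \near F, (f t < a)%E.
Proof.
rewrite limf_esupE => /ereal_inf_lt[_ [V FV <-] supVa].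
apply: filterS FV => t Vt; apply: le_lt_trans supVa.
by apply: ereal_sup_ubound; exists t.
Qed.

(** The set where [f] is at most [a] is itself a member of [F], so its supremum bounds the
    infimum. *)
Lemma limf_esup_le_near (T : choiceType) (X : filteredType T) (R : realType)
    (f : X -> \bar R) (F : set_system X) (a : \bar R) :
  (\forall t \near F, (f t <= a)%E) -> (limf_esup f F <= a)%E.
Proof.
move=> fa; rewrite limf_esupE.
apply: (@le_trans _ _ (ereal_sup [set f t | t in [set t | (f t <= a)%E]])).
  by apply: ereal_inf_lbound; exists [set t | (f t <= a)%E].
by apply: ge_ereal_sup => _ [t fta <-].
Qed.

(** Extracts from a bound on a limit superior a constant that is both real and positive: the
    contraction factor for [y = 1], a bound on the quotients for [y = +oo]. *)
Lemma lte_pos_between (R : realType) (l y : \bar R) :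
  (l < y)%E -> (0 < y)%E ->
  exists r : R, [/\ 0 < r, (l < r%:E)%E &
    (r%:E < y)%E].
Proof.
(* [fine] sends [-oo] to 0, and [ly] excludes [l = +oo], so [m] is a real upper bound of [l]. *)
move=> ly y0; pose m := Num.max 0 (fine l).
have m0 : 0 <= m by rewrite le_max lexx.
have lm : (l <= m%:E)%E.
  rewrite /m; case: l ly {m m0} => [l _||]; last by rewrite leNye.
    by rewrite lee_fin le_max lexx orbT.
  by rewrite ltNge leey.
case: y ly y0 => [y| |]// ly y0; last first.
  exists (m + 1); split; rewrite ?ltry//; first by rewrite ltr_wpDl.
  by apply: le_lt_trans lm _; rewrite lte_fin ltrDl.
have my : m < y.
  rewrite /m gt_max; rewrite lte_fin in y0; rewrite y0 /=.
  by case: l ly {m m0 lm}.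
have [/= mM My] := midf_lt my.
exists ((m + y) / 2); split; first exact: le_lt_trans mM.
  by apply: le_lt_trans lm _; rewrite lte_fin.
by rewrite lte_fin.
Qed.

Lemma ler_powRV (R : realType) (a b M : R) : 0 < b -> 0 <= a ->
  a `^ b <= M -> a <= M `^ b^-1.
Proof.
move=> b0 a0 abM.
rewrite -[leLHS](powRr1 a0) -(divff (lt0r_neq0 b0)) powRrM.
have ab0 : 0 <= a `^ b by exact: powR_ge0.
apply: ge0_ler_powR; rewrite ?nnegrE ?invr_ge0 ?(ltW b0)//.
exact: le_trans abM.
Qed.

Lemma err_ge0 (R : realType) (x : R^nat) (xs : R) (k : nat) : 0 <= err x xs k.
Proof. exact: normr_ge0. Qed.

Section QorderContraction.
Context (R : realType) (x : R^nat) (xs : R) (p : nat).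
Hypothesis x_neq : \forall k \near \oo, x k <> xs.
Hypothesis p_gt0 : (0 < p)%N.

Let e := err x xs.

Let err_gt0_near : \forall k \near \oo, 0 < e k.
Proof.
near=> k; rewrite /e /err normr_gt0 subr_eq0; apply/eqP.
by near: k.
Unshelve. all: by end_near. Qed.

Lemma Qorder1_contraction : (Qbar p 1 x xs < 1)%E ->
  exists c : R, [/\ 0 < c, c < 1 &
    \forall k \near \oo, e (k + p)%N <= c ^+ p * e k].
Proof.
move=> /lte_pos_between/(_ lte01)[c [c0 Qc]]; rewrite lte_fin => c1.
exists c; split => //.
near=> k.
have ek : 0 < e k by near: k; exact: err_gt0_near.
have : ((Qquot p 1 x xs k)%:E < c%:E)%E by near: k; exact: limf_esup_lt_near Qc.
rewrite lte_fin /Qquot eqxx => /ltW /ler_powRV.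
rewrite invrK powR_mulrn ?(ltW c0)// invr_gt0 ltr0n p_gt0.
by rewrite divr_ge0 ?err_ge0// ler_pdivrMr// => ->.
Unshelve. all: by end_near. Qed.

Lemma Qorder_gt1_contraction (alpha c : R) : x k @[k --> \oo] --> xs ->
  1 < alpha -> (Qbar p alpha x xs < +oo)%E -> 0 < c ->
  \forall k \near \oo, e (k + p)%N <= c ^+ p * e k.
Proof.
move=> x_cvg a1 Qoo c0.
have [M [M0 QM _]] := lte_pos_between Qoo (ltry 0).
pose s := alpha ^+ p - 1; pose b := (alpha - 1) / s.
have s0 : 0 < s by rewrite subr_gt0 exprn_egt1// -lt0n.
have b0 : 0 < b by rewrite divr_gt0// subr_gt0.
pose C := M `^ b^-1.
have C0 : 0 < C by exact: powR_gt0.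
(* Solves [C * eps ^ s = c ^ p], so that [e k < eps] makes the factor [C * e k ^ s] at most
   [c ^ p]. *)
pose eps := (c ^+ p / C) `^ s^-1.
have eps0 : 0 < eps by rewrite powR_gt0// divr_gt0// exprn_gt0.
move/cvgrPdist_lt : x_cvg => /(_ _ eps0) x_eps.
near=> k.
have ek : 0 < e k by near: k; exact: err_gt0_near.
have ek_eps : e k < eps.
  by rewrite /e /err distrC; near: k.
have : ((Qquot p alpha x xs k)%:E < M%:E)%E.
  by near: k; exact: limf_esup_lt_near QM.
rewrite lte_fin /Qquot gt_eqF// -/s -/b => /ltW /ler_powRV.
rewrite b0 divr_ge0 ?powR_ge0 ?err_ge0// => /(_ isT isT).
rewrite ler_pdivrMr ?powR_gt0// -/C => /le_trans; apply.
(* Splits off one factor [e k] from the power with exponent [alpha ^+ p], leaving the exponent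
   [s]. *)
rewrite -mulr_powRB1 ?(ltW ek) ?exprn_gt0 ?(lt_trans _ a1)// -/s.
rewrite mulrCA mulrC ler_wpM2r ?(ltW ek)// -ler_pdivlMl// mulrC.
have -> : c ^+ p / C = eps `^ s.
  by rewrite -powRrM mulVf ?gt_eqF// powRr1// divr_ge0 ?exprn_ge0// ltW.
by rewrite ge0_ler_powR ?nnegrE// ltW.
Unshelve. all: by end_near. Qed.

Lemma contraction_Qorder1 (c : R) : 0 < c -> c < 1 ->
  (\forall k \near \oo, e (k + p)%N <= c ^+ p * e k) -> (Qbar p 1 x xs < 1)%E.
Proof.
move=> c0 c1 ec; apply: (@le_lt_trans _ _ c%:E); last by rewrite lte_fin.
apply: limf_esup_le_near; near=> k.
have ek : 0 < e k by near: k; exact: err_gt0_near.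
rewrite lee_fin /Qquot eqxx.
(* Both sides become [p]-th roots, to be compared by monotonicity. *)
have -> : c = (c ^+ p) `^ p%:R^-1.
  rewrite -powR_mulrn ?(ltW c0)// -powRrM divff ?powRr1 ?(ltW c0)//.
  by rewrite pnatr_eq0 -lt0n.
rewrite ge0_ler_powR ?invr_ge0 ?ler0n ?nnegrE ?divr_ge0 ?err_ge0//.
  by rewrite exprn_ge0// ltW.
by rewrite ler_pdivrMr//; near: k.
Unshelve. all: by end_near. Qed.

End QorderContraction.

Theorem proposition3 (R : realType) (x : R^nat) (xs : R) (p : nat)
  (x_cvg : x k @[k --> \oo] --> xs)
  (x_neq : \forall k \near \oo, x k <> xs)
  (p_gt0 : (0 < p)%N) :
  (exists alpha : R, 1 <= alpha /\ Qorder_at_least p alpha x xs) <->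
  (exists c : R, exists K : nat,
     [/\ 0 < c, c < 1, (0 < K)%N &
      forall k : nat, (K <= k)%N ->
        err x xs (k + p)%N <= c ^+ p * err x xs k]).
Proof.
split=> [[alpha [_ Qalpha]]|[c [K [c0 c1 _ ec]]]].
  have [c [c0 c1 [K _ ec]]] : exists c : R, [/\ 0 < c, c < 1 &
      \forall k \near \oo, err x xs (k + p)%N <= c ^+ p * err x xs k].
    case: Qalpha => [[-> /Qorder1_contraction]|[a1 Qoo]]; first exact.
    (* Every positive [c] is admissible when [alpha > 1]; one half is an arbitrary choice below
       1. *)
    exists 2^-1; split; rewrite ?invr_gt0// ?invf_lt1 ?ltr1n//.
    by apply: Qorder_gt1_contraction Qoo _ => //; rewrite invr_gt0.
  (* The successor ensures a positive threshold, as the naturals start at 1 here. *)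
  exists c, K.+1; split=> // k Kk; apply: ec; exact: ltnW Kk.
(* A contraction always yields order at least 1, so [alpha = 1] is the witness. *)
exists 1; split=> //; left; split=> //.
by apply: contraction_Qorder1 c0 c1 _ => //; exists K.
Qed.
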